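(* Let $p_n$ be the proportion of permutations $\gamma\in\mathcal S_n$ for which there exist $\alpha,\beta\in\mathcal S_n$ with $(\alpha,\beta,\gamma;(12))\in\mathrm{Par}(n)$. Then $p_n\to0$ as $n\to\infty$.
   Context: A Latin square of order $n$ is an $n\times n$ array with rows, columns and symbols indexed by $[n]$, each symbol occurring once in each row and each column, with triple set $O(L)$. Permutations act on the right. A paratopism $(\alpha,\beta,\gamma;(12))$ with $\alpha,\beta,\gamma\in\mathcal S_n$ maps $L$ to $L^\sigma$ with triple set $\{(y\beta,x\alpha,z\gamma):(x,y,z)\in O(L)\}$; it is an autoparatopism of $L$ if $L^\sigma=L$. $\mathrm{Par}(n)$ is the set of paratopisms that are autoparatopisms of at least one Latin square of order $n$. *)

(* Defs.v *)
From HB Require Import structures.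
From mathcomp Require Import all_boot all_order all_algebra all_fingroup.
From mathcomp Require Import all_classical all_reals all_analysis.
Set Implicit Arguments. Unset Strict Implicit. Unset Printing Implicit Defensive.

Definition latin (n : nat) (L : {ffun 'I_n * 'I_n -> 'I_n}) : bool :=
  [forall x, injectiveb (fun y => L (x, y))] &&
  [forall y, injectiveb (fun x => L (x, y))].

Definition triple (n : nat) := ('I_n * 'I_n * 'I_n)%type.

Definition OL (n : nat) (L : {ffun 'I_n * 'I_n -> 'I_n}) : {set triple n} :=
  [set t : triple n | L (t.1.1, t.1.2) == t.2].

(* Image of a triple set under the paratopism (alpha, beta, gamma; (12)):
   (x,y,z) |-> (y beta, x alpha, z gamma). Permutations act on the right,
   x alpha is written (alpha x). *)
Definition para12 (n : nat) (a b c : {perm 'I_n}) (S : {set triple n})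
  : {set triple n} :=
  [set (b t.1.2, a t.1.1, c t.2) | t in S].

Definition autopara12 (n : nat) (a b c : {perm 'I_n})
  (L : {ffun 'I_n * 'I_n -> 'I_n}) : bool :=
  para12 a b c (OL L) == OL L.

Definition inPar12 (n : nat) (a b c : {perm 'I_n}) : bool :=
  [exists L : {ffun 'I_n * 'I_n -> 'I_n}, latin L && autopara12 a b c L].

Definition goodGamma (n : nat) : {set {perm 'I_n}} :=
  [set c : {perm 'I_n} | [exists a : {perm 'I_n}, exists b : {perm 'I_n},
      inPar12 a b c]].

Definition p_ (R : realType) (n : nat) : R :=
  (#|goodGamma n|%:R / #|{perm 'I_n}|%:R)%R.

(* Main.v *)
Require Import Defs.
From HB Require Import structures.
From mathcomp Require Import all_boot all_order all_algebra all_fingroup.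
From mathcomp Require Import all_classical all_reals all_analysis.
(* Imported again because [all_classical] shadows [subsetP], [setCK], [trivIsetP], etc. *)
From mathcomp Require Import fintype finset.
From mathcomp Require Import zify ring lra.

(** If (alpha, beta, gamma; (12)) is an autoparatopism of L, its square is the autotopism
(f, g, gamma^2) with f and g conjugate. For an odd prime p, call a point p-free if its cycle
length is prime to p; in a triple of L two p-free entries force the third to be p-free. So if
some but fewer than n/2 symbols lie on gamma-cycles of length divisible by p, then no row is
p-free: a p-free row would yield a subsquare on the p-free rows, columns and symbols that is
proper but has side > n/2. Hence every cycle of f has length divisible by p and p divides n.

For a random gamma this fails. Fix K and let A be a set of lengths l <= n/4, each with a prime
factor q(l) > K not dividing n, and let W be the sum of 1/l over A. By a second moment estimate
gamma has no cycle with length in A with probability at most 1/W. Given a cycle of length l in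
A, the number of points outside it on cycles of length divisible by q(l) has mean at most n/K,
so by Markov the probability that q(l) divides the cycle lengths of at least n/2 symbols is at
most 4W/K in total. Finally W can be given any prescribed size, up to an error at most 1, once n
is large: the numbers all of whose primes divide N = K! n have reciprocal sum at most
prod_{p | N} p/(p-1) <= omega(N) + 1 = o(log n), and lengths can be removed from A one by one. *)

Set Implicit Arguments. Unset Strict Implicit. Unset Printing Implicit Defensive.

Import Order.TTheory GRing.Theory Num.Theory.

(** * Cycle lengths of an autoparatopism *)

Lemma porbit_iter_eq (T : finType) (c : {perm T}) (x : T) (m : nat) :
  (iter m c x == x) = (#|porbit c x| %| m).
Proof.
have lt0 : 0 < #|porbit c x| by rewrite lt0n card_porbit_neq0.
rewrite {1}(divn_eq m #|porbit c x|) addnC iterD.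
have -> : iter (m %/ #|porbit c x| * #|porbit c x|) c x = x.
  by elim: (m %/ _) => [|k IH] //; rewrite mulSn addnC iterD iter_porbit.
rewrite /dvdn; have lt_r := ltn_pmod m lt0.
apply/idP/idP => [/eqP eq_r|/eqP-> //].
have /(nth_uniq x) := uniq_traject_porbit c x.
move=> /(_ (m %% #|porbit c x|) 0); rewrite size_traject => /(_ lt_r lt0) <-.
by rewrite !nth_traject //= eq_r.
Qed.

(** Expressing p-freeness by a return time prime to [p], not only by the exact cycle length, lets
    return times of different entries of a triple be multiplied. *)
Lemma prime_ndvd_porbitP (T : finType) (c : {perm T}) (x : T) (p : nat) :
  prime p ->
  reflect (exists2 m, ~~ (p %| m) & iter m c x = x) (~~ (p %| #|porbit c x|)).
Proof.
move=> p_pr; apply: (iffP idP) => [pNx | [m pNm /eqP]].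
  by exists #|porbit c x|; rewrite ?iter_porbit.
by rewrite porbit_iter_eq => dvd_m; apply: contra pNm => /dvdn_trans->.
Qed.

Lemma dvdn_card_porbits (T : finType) (c : {perm T}) (d : nat) :
  (forall x, d %| #|porbit c x|) -> d %| #|T|.
Proof.
move=> dvd_c; rewrite -cardsT (card_partition (P := porbits c)).
  by apply: dvdn_sum => _ /imsetP[x _ ->].
apply/and3P; split.
- by apply/eqP/setP=> x; rewrite inE; apply/bigcupP; exists (porbit c x);
  rewrite ?imset_f ?porbit_id.
- apply/trivIsetP => _ _ /imsetP[x _ ->] /imsetP[y _ ->] neq_xy.
  rewrite -setI_eq0; apply: contraNT neq_xy => /set0Pn[z].
  by rewrite inE ![z \in _]porbit_sym -!eq_porbit_mem => /andP[/eqP-> /eqP->].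
- by apply/imsetP => -[x _ /setP/(_ x)]; rewrite inE porbit_id.
Qed.

Section Autoparatopism.

Variables (n : nat) (a b c : {perm 'I_n}) (L : {ffun 'I_n * 'I_n -> 'I_n}).
Hypotheses (latL : latin L) (autL : autopara12 a b c L).

Let injr x : injective (fun y => L (x, y)).
Proof. by case/andP: latL => /forallP/(_ x)/injectiveP. Qed.

Let injc y : injective (fun x => L (x, y)).
Proof. by case/andP: latL => _ /forallP/(_ y)/injectiveP. Qed.

Lemma autopara12E x y : L (b y, a x) = c (L (x, y)).
Proof.
have : (x, y, L (x, y)) \in OL L by rewrite inE.
move/(imset_f (fun t : triple n => (b t.1.2, a t.1.1, c t.2))) => /=.
by rewrite -[imset _ _]/(para12 a b c (OL L)) (eqP autL) inE => /eqP.
Qed.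

Lemma autopara12_iter k x y :
  L (iter k (a * b)%g x, iter k (b * a)%g y) = iter k (c * c)%g (L (x, y)).
Proof. by elim: k => //= k <-; rewrite !permM !autopara12E. Qed.

(** Row, column and symbol move together under the squared paratopism, so the product of return
    times of two entries is a return time of the third. *)
Lemma autopara12_ndvd_porbit (p : nat) x y :
    prime p -> odd p -> ~~ (p %| #|porbit (a * b) x|) ->
  (p %| #|porbit (b * a) y|) = (p %| #|porbit c (L (x, y))|).
Proof.
move=> p_pr p_odd /(prime_ndvd_porbitP _ _ p_pr)[m pNm xm].
have iter_mul (T : finType) (d : {perm T}) z i j : iter i d z = z -> iter (i * j) d z = z.
  by move/eqP; rewrite porbit_iter_eq => /dvdn_mulr H; apply/eqP; rewrite porbit_iter_eq.
have iter_sq k z : iter k (c * c)%g z = iter (k * 2) c z.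
  by elim: k => //= k ->; rewrite permM.
apply: negb_inj; apply/prime_ndvd_porbitP/prime_ndvd_porbitP => // -[k pNk zk].
(* One step of [c * c] is two steps of [c]; the factor 2 is prime to [p] because [p] is odd. *)
- exists (m * k * 2).
    rewrite !Euclid_dvdM // (negPf pNm) (negPf pNk) dvdn_prime2 //.
    by apply: contraL p_odd => /eqP->.
  by rewrite -iter_sq -autopara12_iter iter_mul // mulnC iter_mul.
exists (m * k); first by rewrite Euclid_dvdM // (negPf pNm).
apply: (injr (x := x)) => /=; rewrite -{1}(iter_mul _ _ _ _ k xm).
by rewrite autopara12_iter iter_sq mulnAC mulnC iter_mul.
Qed.

Lemma autopara12_prime_cycles (p : nat) (z0 : 'I_n) :
    prime p -> odd p -> ~~ (p %| n) -> p %| #|porbit c z0| ->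
  n <= #|[set z | p %| #|porbit c z|]| * 2.
Proof.
move=> p_pr p_odd pNn pz0; rewrite leqNgt; apply/negP => ltSn.
set S := [set z | _] in ltSn; have Sz0 : z0 \in S by rewrite inE.
have [x0 x0N] : exists x, ~~ (p %| #|porbit (a * b) x|).
  apply/existsP; rewrite -negb_forall; apply: contra pNn => /forallP dvdp.
  by rewrite -[n in _ %| n]card_ord (dvdn_card_porbits (c := (a * b)%g)).
pose R' := [set x | ~~ (p %| #|porbit (a * b) x|)].
pose C' := [set y | ~~ (p %| #|porbit (b * a) y|)].
have dvdL x y : x \in R' -> (y \in C') = (L (x, y) \notin S).
  by rewrite !inE => xR; rewrite (autopara12_ndvd_porbit y p_pr p_odd xR).
have R'x0 : x0 \in R' by rewrite inE.
have surj x z : exists y, L (x, y) = z.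
  by have [g _ gK] := injF_bij (@injr x); exists (g z); apply: gK.
(* Row [x0] maps the p-free columns bijectively onto the symbols outside [S]. *)
have card_C' : #|S| + #|C'| = n.
  rewrite -(card_imset (mem C') (@injr x0)) -[RHS](card_ord n) -(cardsC S); congr addn.
  apply: eq_card => z; rewrite inE; apply/imsetP/idP => [[y C'y ->]|].
    by rewrite -dvdL.
  by have [y <-] := surj x0 z; rewrite -dvdL // => ?; exists y.
(* [b] conjugates [b * a] to [a * b], so it sends p-free columns to p-free rows. *)
have card_R' : #|C'| <= #|R'|.
  rewrite -(card_imset (mem C') (@perm_inj _ b)); apply/subset_leq_card/subsetP.
  move=> _ /imsetP[y C'y ->]; move: C'y; rewrite !inE.
  move=> /(prime_ndvd_porbitP _ _ p_pr)[k pNk yk].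
  apply/(prime_ndvd_porbitP _ _ p_pr); exists k => //.
  have -> : iter k (a * b)%g (b y) = b (iter k (b * a)%g y).
    by elim: k {pNk yk} => //= k ->; rewrite !permM.
  by rewrite yk.
have [y0 Ly0] := surj x0 z0.
(* Column [y0] meets row [x0] in a symbol of [S], so it is not p-free and meets every p-free row in
   [S]. With the two counts above, [n - #|S| <= #|S|], contrary to [ltSn]. *)
have : #|R'| <= #|S|.
  rewrite -(card_imset (mem R') (@injc y0)); apply/subset_leq_card/subsetP.
  move=> _ /imsetP[x R'x ->]; apply: contraT; rewrite -dvdL //.
  by rewrite (dvdL x0 y0) // Ly0 Sz0.
lia.
Qed.

End Autoparatopism.

(** * Moments of cycle counts *)

Lemma card_perm_type (T : finType) : #|{perm T}| = (#|T|)`!.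
Proof.
rewrite -cardsT -card_perm; apply: eq_card => c; rewrite inE.
by apply/esym/subsetP => x; rewrite !inE.
Qed.

(** Multiplying by the inverse of one member turns all members into permutations fixing [s]
    pointwise. *)
Lemma card_perm_agree (T : finType) (P : pred {perm T}) (s : seq T) :
    uniq s -> {in P &, forall c d : {perm T}, forall x, x \in s -> c x = d x} ->
  #|P| <= (#|T| - size s)`!.
Proof.
move=> s_uniq agree; have [c0 Pc0|P0] := pickP P; last by rewrite eq_card0.
have -> : #|T| - size s = #|~: [set x in s]|.
  by rewrite cardsCs setCK cardsE (card_uniqP s_uniq).
rewrite -card_perm -(card_imset P (mulIg c0^-1%g)).
apply/subset_leq_card/subsetP => _ /imsetP[c Pc ->].
apply/subsetP => x; rewrite !inE; apply: contra => sx.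
by rewrite permM (agree c c0) // permK.
Qed.

Lemma porbit_traject_agree (T : finType) (c d : {perm T}) (x : T) :
    #|porbit c x| = #|porbit d x| ->
    traject c x #|porbit c x| = traject d x #|porbit c x| ->
  {in porbit c x, c =1 d}.
Proof.
move=> eq_l eq_t z; rewrite porbit_traject => /trajectP[i lt_i ->].
have eq_iter j : j <= #|porbit c x| -> iter j c x = iter j d x.
  rewrite leq_eqVlt => /predU1P[->|lt_j]; first by rewrite {2}eq_l !iter_porbit.
  by rewrite -!(nth_traject _ lt_j) eq_t.
by rewrite -iterS eq_iter // (eq_iter i) // ltnW.
Qed.

(** In the applications [h c] lists the remaining points of the cycles through [s]. There are at
    most [(#|T| - size s) ^_ k] values of [h], each leaving at most [(#|T| - size s - k)!]
    permutations. *)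
Lemma card_perm_determined (T : finType) (E : {set {perm T}}) (s : seq T)
    (k : nat) (h : {perm T} -> k.-tuple T) :
    {in E, forall c, uniq (s ++ h c)} ->
    {in E &, forall c d, h c = h d -> {in s ++ h c, c =1 d}} ->
  #|E| <= (#|T| - size s)`!.
Proof.
move=> Euniq Eagree; have [-> | [c0 Ec0]] := set_0Vmem E; first by rewrite cards0.
have s_uniq : uniq s by have := Euniq _ Ec0; rewrite cat_uniq => /andP[].
have le_n : size s + k <= #|T|.
  have /card_uniqP := Euniq _ Ec0; rewrite size_cat size_tuple => <-.
  exact: max_card.
pose D := [set t : k.-tuple T | all (predC (mem s)) t & uniq t].
have hD c : c \in E -> h c \in D.
  move=> /Euniq; rewrite inE cat_uniq => /and3P[_ nh ->]; rewrite andbT.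
  by apply/allP => z zin /=; apply: contra nh => zs; apply/hasP; exists z.
rewrite -sum1_card (partition_big h (mem D)) //=.
apply: (@leq_trans (\sum_(t in D) (#|T| - (size s + k))`!)).
  apply: leq_sum => t _; rewrite sum1_card.
  have [c1 /andP[Ec1 /eqP hc1]|P0] := pickP [pred c | (c \in E) && (h c == t)]; last first.
    by rewrite eq_card0.
  have /card_perm_agree := Euniq _ Ec1.
  rewrite size_cat size_tuple; apply => c d.
  rewrite !unfold_in /= => /andP[Ec /eqP hc] /andP[Ed /eqP hd] z zin.
  by apply: Eagree; rewrite ?hc ?hd // -hc1.
rewrite sum_nat_const card_uniq_tuples.
have -> : #|predC (mem s)| = #|T| - size s.
  by rewrite -(cardC (mem s)) (card_uniqP s_uniq) addKn.
by rewrite subnDA ffact_fact //; lia.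
Qed.

Definition traject_tuple (T : Type) (f : T -> T) (x : T) (k : nat) : k.-tuple T :=
  Tuple (introT eqP (size_traject f x k)).

Lemma card_perm_porbit_le (T : finType) (x : T) (l : nat) :
  #|[set c : {perm T} | #|porbit c x| == l]| <= (#|T| - 1)`!.
Proof.
set E := [set c | _]; have [-> | [c0]] := set_0Vmem E; first by rewrite cards0.
case: l @E => [|l] E; rewrite inE.
  by rewrite eqn0Ngt lt0n card_porbit_neq0.
move=> _; apply: (card_perm_determined (s := [:: x]) (h := fun c => traject_tuple c (c x) l)).
  by move=> c; rewrite inE => /eqP eq_l; have := uniq_traject_porbit c x; rewrite eq_l.
move=> c d; rewrite !inE => /eqP eq_c /eqP eq_d /(congr1 val) /= eq_t z zin.
by apply: (@porbit_traject_agree _ _ _ x); rewrite ?porbit_traject eq_c ?eq_d //= eq_t.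
Qed.

Lemma card_perm_two_porbits (T : finType) (x y : T) (l m : nat) :
  #|[set c : {perm T} | [&& #|porbit c x| == l, #|porbit c y| == m
                          & y \notin porbit c x]]| <= (#|T| - 2)`!.
Proof.
set E := [set c | _]; have [-> | [c0]] := set_0Vmem E; first by rewrite cards0.
case: l m @E => [|l] [|m] E; rewrite inE; do ?by rewrite eqn0Ngt lt0n card_porbit_neq0 ?andbF.
have perm_s c : perm_eq ([:: x; y] ++ traject c (c x) l ++ traject c (c y) m)
                        (traject c x l.+1 ++ traject c y m.+1).
  rewrite [traject c x _]/= [traject c y _]/= /= perm_cons.
  by rewrite -cat1s perm_catCA.
move=> _; apply: (card_perm_determined (s := [:: x; y])
  (h := fun c => [tuple of traject_tuple c (c x) l ++ traject_tuple c (c y) m])) => [c|c d].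
  rewrite inE => /and3P[/eqP eq_l /eqP eq_m yNx].
  rewrite -[uniq _]/(uniq ([:: x; y] ++ traject c (c x) l ++ traject c (c y) m)).
  rewrite (perm_uniq (perm_s c)) cat_uniq -{1}eq_l -eq_m !uniq_traject_porbit andbT /=.
  apply/hasPn => z; rewrite -porbit_traject => zy.
  apply: contra yNx => /= zx.
  rewrite (_ : x :: _ = traject c x l.+1) // -eq_l -porbit_traject in zx.
  by move: zy zx; rewrite -!eq_porbit_mem => /eqP->.
rewrite !inE => /and3P[/eqP cl /eqP cm _] /and3P[/eqP dl /eqP dm _] /(congr1 val) /= /eqP.
rewrite eqseq_cat ?size_traject // => /andP[/eqP eq_x /eqP eq_y] z.
rewrite -[z \in _]/(z \in [:: x; y] ++ traject c (c x) l ++ traject c (c y) m).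
rewrite (perm_mem (perm_s c)) mem_cat -{1}cl -cm -!porbit_traject => /orP[].
  by apply: porbit_traject_agree; rewrite ?cl ?dl //= eq_x.
by apply: porbit_traject_agree; rewrite ?cm ?dm //= eq_y.
Qed.

Lemma porbit_pred_lt (T : finType) (c : {perm T}) (x : T) :
  #|porbit c x|.-1 < #|T|.
Proof. by rewrite prednK ?max_card // lt0n card_porbit_neq0. Qed.

Definition porbit_idx (T : finType) (x : T) (c : {perm T}) : 'I_#|T| :=
  Ordinal (porbit_pred_lt c x).

Lemma porbit_idxS (T : finType) (x : T) (c : {perm T}) :
  #|porbit c x| = (porbit_idx x c).+1.
Proof. by rewrite /= prednK // lt0n card_porbit_neq0. Qed.

Lemma porbit_idx_eq (T : finType) (x : T) (c : {perm T}) (l : 'I_#|T|) :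
  (porbit_idx x c == l) = (#|porbit c x| == l.+1).
Proof. by rewrite porbit_idxS. Qed.

(** The [#|T|] upper bounds [(#|T| - 1)!] add up to the number of all permutations, so each of them
    is attained. *)
Lemma card_perm_porbit (T : finType) (x : T) (l : 'I_#|T|) :
  #|[set c : {perm T} | #|porbit c x| == l.+1]| = (#|T| - 1)`!.
Proof.
have T_gt0 : 0 < #|T| by apply/card_gt0P; exists x.
have le_l (k : 'I_#|T|) : true -> #|[set c : {perm T} | #|porbit c x| == k.+1]|
    <= (#|T| - 1)`! ?= iff (#|[set c : {perm T} | #|porbit c x| == k.+1]| == (#|T| - 1)`!).
  by move=> _; split=> //; apply: card_perm_porbit_le.
have [_ /esym] := leqif_sum le_l.
have -> : \sum_(k < #|T|) #|[set c : {perm T} | #|porbit c x| == k.+1]| = (#|T|)`!.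
  rewrite -card_perm_type -[RHS]sum1_card.
  rewrite (partition_big (porbit_idx x) predT) //=; apply: eq_bigr => k _.
  rewrite -[LHS]sum1_card; apply: eq_bigl => c.
  by rewrite inE porbit_idx_eq.
rewrite sum_nat_const card_ord; have -> : #|T| * (#|T| - 1)`! = (#|T|)`!.
  by rewrite subn1 -{1}(prednK T_gt0) -factS prednK.
by rewrite eqxx => /forallP/(_ l)/eqP.
Qed.

Local Open Scope ring_scope.

Lemma sum_porbit (R : numDomainType) (T : finType) (F : nat -> R) :
  \sum_(c : {perm T}) \sum_x F #|porbit c x| = (#|T|)`!%:R * \sum_(l < #|T|) F l.+1.
Proof.
rewrite exchange_big /=.
have -> : (#|T|)`!%:R * \sum_(l < #|T|) F l.+1 =
    \sum_(x : T) (#|T| - 1)`!%:R * \sum_(l < #|T|) F l.+1.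
  rewrite sumr_const cardT -cardE -mulrnAl -mulrnA.
  case: #|T| => [|n]; first by rewrite big_ord0 !mulr0.
  by rewrite factS mulnC subSS subn0.
apply: eq_bigr => x _; rewrite (partition_big (porbit_idx x) predT) //= mulr_sumr.
apply: eq_bigr => l _; rewrite -(card_perm_porbit x l) -[in RHS]sum1_card natr_sum mulr_suml.
apply: eq_big => [c | c]; first by rewrite inE porbit_idx_eq.
by rewrite porbit_idx_eq => /eqP->; rewrite mul1r.
Qed.

(** Each of the [#|T| * (#|T| - 1)] ordered pairs of distinct points realises given lengths on
    separate cycles in at most [(#|T| - 2)!] permutations. *)
Lemma sum_two_porbits_le (R : numDomainType) (T : finType) (F : nat -> nat -> R) :
    (forall l m, 0 <= F l m) ->
  \sum_(c : {perm T}) \sum_x \sum_(y | y \notin porbit c x) F #|porbit c x| #|porbit c y|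
    <= (#|T|)`!%:R * \sum_(l < #|T|) \sum_(m < #|T|) F l.+1 m.+1.
Proof.
move=> F_ge0; set W := \sum_(l < _) _.
have W_ge0 : 0 <= W by apply: sumr_ge0 => l _; apply: sumr_ge0.
have xy_le (x y : T) :
    \sum_(c : {perm T} | y \notin porbit c x) F #|porbit c x| #|porbit c y|
      <= (x != y)%:R * ((#|T| - 2)`!%:R * W).
  have [<-|_] := eqVneq x y.
    by rewrite mul0r big_pred0 // => c; rewrite porbit_id.
  rewrite mul1r (partition_big (fun c => (porbit_idx x c, porbit_idx y c)) predT) //=.
  rewrite /W pair_big /= mulr_sumr; apply: ler_sum => -[l m] _ /=.
  apply: le_trans (_ : \sum_(c in [set c : {perm T} | [&& #|porbit c x| == l.+1,
      #|porbit c y| == m.+1 & y \notin porbit c x]]) F l.+1 m.+1 <= _).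
    rewrite le_eqVlt; apply/orP; left; apply/eqP; apply: eq_big => [c | c /andP[_ /eqP[<- <-]]].
      by rewrite inE xpair_eqE -!porbit_idx_eq andbC andbA.
    by rewrite -!porbit_idxS.
  by rewrite sumr_const -[leLHS]mulr_natl ler_wpM2r // ler_nat card_perm_two_porbits.
rewrite exchange_big /=; under eq_bigr => x _.
  rewrite (exchange_big_dep predT) //=; over.
apply: le_trans (_ : \sum_(x : T) \sum_(y : T) (x != y)%:R * ((#|T| - 2)`!%:R * W) <= _).
  by apply: ler_sum => x _; apply: ler_sum => y _.
apply: le_trans (_ : \sum_(x : T) (#|T| - 1)%:R * ((#|T| - 2)`!%:R * W) <= _).
  apply: ler_sum => x _; rewrite -mulr_suml -natr_sum ler_wpM2r ?mulr_ge0 //.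
  rewrite ler_nat subn1 -(cardC1 x) -sum1_card [leqRHS]big_mkcond.
  by apply: leq_sum => y _; rewrite !inE eq_sym; case: eqP.
rewrite sumr_const cardT -cardE -mulrnAl -mulrnA mulrA -natrM ler_wpM2r // ler_nat.
have fact2 (k : nat) : ((k - 1) * k * (k - 2)`! <= k`!)%N.
  by case: k => [|[|k]] //; rewrite !factS !subSS !subn0 mulnA (mulnC k.+1).
exact: fact2.
Qed.

Lemma card_porbit_mem (T : finType) (c : {perm T}) (x y : T) :
  y \in porbit c x -> #|porbit c y| = #|porbit c x|.
Proof. by rewrite -eq_porbit_mem => /eqP->. Qed.

Section CycleLengths.

Variables (R : realFieldType) (T : finType) (A : pred nat).

(** The expected number of cycles with length in [A] of a uniform random permutation of [T]. *)
Definition harmonic_mass : R := \sum_(l < #|T| | A l.+1) l.+1%:R^-1.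

Let F (l : nat) : R := (A l)%:R / l%:R.
Let N : R := (#|T|)`!%:R.

Let F_ge0 l : 0 <= F l. Proof. by rewrite divr_ge0. Qed.

Let sumF : \sum_(l < #|T|) F l.+1 = harmonic_mass.
Proof.
rewrite /harmonic_mass [RHS]big_mkcond; apply: eq_bigr => l _.
by rewrite /F; case: (A _); rewrite ?mul1r ?mul0r.
Qed.

(* Summing [F] over the points of a permutation counts its cycles with length in [A]. *)
Let X (c : {perm T}) : R := \sum_x F #|porbit c x|.

Let sumX : \sum_c X c = N * harmonic_mass.
Proof. by rewrite sum_porbit sumF. Qed.

Let sumX2 : \sum_c X c ^+ 2 <= N * (harmonic_mass + harmonic_mass ^+ 2).
Proof.
(* For fixed [x] on a cycle of length [l] in [A], the points [y] of the same cycle contribute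
   [l / l ^ 2 = 1 / l]. *)
have X2E c : X c ^+ 2 = X c +
    \sum_x \sum_(y | y \notin porbit c x) F #|porbit c x| * F #|porbit c y|.
  rewrite expr2 {1 3}/X mulr_suml -big_split /=; apply: eq_bigr => x _.
  rewrite /X mulr_sumr (bigID (mem (porbit c x))) /=; congr (_ + _).
  rewrite (eq_bigr (fun=> F #|porbit c x| * F #|porbit c x|)); last first.
    by move=> y /card_porbit_mem->.
  rewrite sumr_const -mulr_natl /F.
  have : #|porbit c x|%:R != 0 :> R by rewrite pnatr_eq0 card_porbit_neq0.
  by case: (A _) => h; rewrite ?mul0r ?mulr0 ?mul1r //; field.
under eq_bigr do rewrite X2E.
rewrite big_split /= sumX mulrDr lerD2l.
apply: le_trans (sum_two_porbits_le T (F := fun l m => F l * F m) _) _.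
  by move=> l m; rewrite mulr_ge0.
rewrite ler_wpM2l ?ler0n // -sumF expr2 mulr_suml.
by apply: ler_sum => l _; rewrite mulr_sumr.
Qed.

(** Chebyshev: [X] has mean [W] and variance at most [W], while it deviates by [W] on the counted
    permutations. *)
Lemma card_perm_no_porbit_le : 0 < harmonic_mass ->
  #|[set c : {perm T} | [forall x, ~~ A #|porbit c x|]]|%:R <= N / harmonic_mass.
Proof.
move=> W_gt0; set Z := [set c | _]; set W := harmonic_mass in W_gt0 *.
rewrite ler_pdivlMr // -(ler_pM2r W_gt0) -mulrA -expr2.
have -> : #|Z|%:R * W ^+ 2 = \sum_(c in Z) (X c - W) ^+ 2.
  rewrite mulr_natl -sumr_const; apply: eq_bigr => c; rewrite inE => /forallP cA.
  rewrite [X c]big1 ?sub0r ?sqrrN // => x _.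
  by rewrite /F (negPf (cA x)) mul0r.
apply: le_trans (_ : \sum_c (X c - W) ^+ 2 <= _).
  by rewrite [leRHS](bigID (mem Z)) /= lerDl sumr_ge0 // => c _; apply: sqr_ge0.
under eq_bigr do rewrite sqrrB -mulr_natr.
rewrite !big_split /= sumr_const card_perm_type.
rewrite sumrN -!mulr_suml sumX.
have := sumX2; rewrite -/W -mulr_natl -/N; nra.
Qed.

End CycleLengths.

(** * Admissible permutations for a fixed set of lengths *)

Lemma sum_dvdn_le (q n : nat) : (0 < q)%N ->
  ((\sum_(m < n) (q %| m.+1)) * q <= n)%N.
Proof.
move=> q_gt0; suff -> : (\sum_(m < n) (q %| m.+1) = n %/ q)%N by apply: leq_trunc_div.
elim: n => [|n IH]; first by rewrite big_ord0 div0n.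
by rewrite big_ord_recr /= IH divnS // addnC.
Qed.

(** The first term covers permutations with no cycle length in [A]; the second is Markov's
    inequality for the others. *)
Lemma card_goodGamma_le (R : realFieldType) (n : nat) (A : pred nat) (q : nat -> nat) (K : nat) :
    (0 < K)%N ->
    (forall l, A l -> [/\ (4 * l <= n)%N, prime (q l), odd (q l), (q l %| l)%N
                        & ~~ (q l %| n)%N]) ->
    (forall l, A l -> (K <= q l)%N) ->
    0 < harmonic_mass R 'I_n A ->
  #|goodGamma n|%:R <=
    n`!%:R * ((harmonic_mass R 'I_n A)^-1 + 4 * harmonic_mass R 'I_n A / K%:R).
Proof.
move=> K_gt0 qP qK W_gt0; set W := harmonic_mass _ _ _ in W_gt0 *.
pose Z := [set c : {perm 'I_n} | [forall x, ~~ A #|porbit c x|]].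
(* The weight [1 / l] adds up to 1 over a cycle, so [Y] counts pairs of a cycle with length [l] in
   [A] and a point outside it whose cycle length is divisible by [q l]. *)
pose F l m : R := (A l && (q l %| m)%N)%:R / l%:R.
have F_ge0 l m : 0 <= F l m by rewrite divr_ge0.
pose Y (c : {perm 'I_n}) := \sum_x \sum_(y | y \notin porbit c x) F #|porbit c x| #|porbit c y|.
have Y_ge0 c : 0 <= Y c by apply: sumr_ge0 => x _; apply: sumr_ge0.
have sumY : \sum_c Y c <= n`!%:R * (n%:R * W / K%:R).
  apply: le_trans (sum_two_porbits_le _ F_ge0) _.
  rewrite card_ord ler_wpM2l ?ler0n // [n%:R * W]mulrC -mulrA mulr_suml.
  rewrite card_ord [leRHS]big_mkcond; apply: ler_sum => l _ /=.
  rewrite /F; case: ifP => [Al|_]; last by rewrite big1 // => m _; rewrite mul0r.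
  have qKl := qK _ Al; have q_gt0 : (0 < q l.+1)%N by apply: leq_trans qKl.
  rewrite -mulr_suml mulrC ler_wpM2l ?invr_ge0 ?ler0n // -natr_sum /=.
  rewrite ler_pdivlMr ?ltr0n // -natrM ler_nat.
  by apply: leq_trans (sum_dvdn_le n q_gt0); rewrite leq_mul2l qKl orbT.
have Y_large c : c \in goodGamma n :\: Z -> n%:R <= 4 * Y c.
  rewrite !inE negb_forall => /andP[/existsP[x]].
  rewrite negbK => Ax /existsP[a /existsP[b /existsP[L /andP[latL autL]]]].
  set l := #|porbit c x| in Ax; have [l4 p_pr p_odd pl pNn] := qP _ Ax.
  have l_gt0 : (0 < l)%N by rewrite lt0n card_porbit_neq0.
  have := autopara12_prime_cycles latL autL p_pr p_odd pNn pl.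
  set S := [set z | _] => leS.
  (* At least [n / 2] points lie in [S], and the cycle of [x] removes at most [l <= n / 4] of
     them. *)
  have leD : (n <= 4 * #|S :\: porbit c x|)%N.
    have := cardsID (porbit c x) S; have := subset_leq_card (subsetIr S (porbit c x)).
    rewrite -/l; lia.
  suff : #|S :\: porbit c x|%:R <= Y c.
    move=> leY; apply: le_trans (_ : (4 * #|S :\: porbit c x|)%:R <= _).
      by rewrite ler_nat.
    by rewrite natrM ler_wpM2l.
  rewrite /Y (bigID (mem (porbit c x))) /= -[leLHS]addr0; apply: lerD; last first.
    by apply: sumr_ge0 => y _; apply: sumr_ge0.
  apply: le_trans (_ : \sum_(z in porbit c x) #|S :\: porbit c x|%:R / l%:R <= _).
    rewrite sumr_const -/l -[leRHS]mulr_natr divfK // pnatr_eq0 -lt0n //.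
  apply: ler_sum => z zx; rewrite (card_porbit_mem zx) -/l.
  rewrite -mulr_suml ler_wpM2r ?invr_ge0 ?ler0n // -natr_sum ler_nat Ax /=.
  have /eqP-> : porbit c z == porbit c x by rewrite eq_porbit_mem.
  rewrite -sum1_card [leqRHS]big_mkcond [leqLHS]big_mkcond.
  by apply: leq_sum => y _; rewrite !inE; case: (y \in _).
have goodS : (#|goodGamma n| <= #|Z| + #|goodGamma n :\: Z|)%N.
  by rewrite -(cardsID Z (goodGamma n)) leq_add2r subset_leq_card ?subsetIr.
have [n0|n_gt0] := posnP n.
  by move: W_gt0; rewrite /W /harmonic_mass big1 ?ltxx // => -[l]; rewrite card_ord n0.
apply: le_trans (_ : (#|Z| + #|goodGamma n :\: Z|)%:R <= _); first by rewrite ler_nat.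
rewrite natrD mulrDr; apply: lerD.
  by have := card_perm_no_porbit_le W_gt0; rewrite card_ord.
have n_gt0' : 0 < n%:R :> R by rewrite ltr0n.
rewrite -(ler_pM2r n_gt0').
apply: le_trans (_ : \sum_(c in goodGamma n :\: Z) 4 * Y c <= _).
  by rewrite mulr_natl -sumr_const; apply: ler_sum.
rewrite -mulr_sumr; apply: le_trans (_ : 4 * \sum_c Y c <= _).
  rewrite ler_wpM2l // [leRHS](bigID (mem (goodGamma n :\: Z))) /= lerDl.
  exact: sumr_ge0.
have -> : n`!%:R * (4 * W / K%:R) * n%:R = 4 * (n`!%:R * (n%:R * W / K%:R)) by ring.
by rewrite ler_wpM2l.
Qed.

(** * Reciprocal sums over smooth numbers *)

Local Open Scope nat_scope.

(** The i-th entry is at least [k + i]. For the prime factors of a number this bounds how many there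
    are. *)
Lemma path_ltn_prod (k : nat) (s : seq nat) :
  path ltn k s -> (k + size s)`! <= k`! * \prod_(p <- s) p.
Proof.
elim: s k => [|p s IH] k /=; first by rewrite big_nil muln1 addn0.
case/andP=> lt_kp p_s; rewrite big_cons addnS -addSn mulnA.
have /IH/leq_trans : path ltn k.+1 s.
  by case: s p_s {IH} => //= r s /andP[lt_pr ->]; rewrite (leq_ltn_trans lt_kp).
by apply; rewrite leq_mul2r factS mulnC leq_mul2l lt_kp !orbT.
Qed.

Lemma prod_primes_le (n : nat) : 0 < n -> \prod_(p <- primes n) p <= n.
Proof.
move=> n_gt0; rewrite {2}(prod_prime_decomp n_gt0) prime_decompE big_map /= big_seq [leqRHS]big_seq.
apply: leq_prod => p; rewrite mem_primes => /and3P[p_pr _ p_n].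
by rewrite -{1}(expn1 p) leq_exp2l ?prime_gt1 // logn_gt0 mem_primes p_pr n_gt0.
Qed.

Lemma expn_le_fact (a m : nat) : 0 < a -> a ^ m <= a ^ a * m`!.
Proof.
move=> a_gt0; elim: m => [|m IH]; first by rewrite fact0 muln1 expn0 expn_gt0 a_gt0.
have [lt_ma|le_am] := ltnP m a.
  apply: leq_trans (_ : a ^ a <= _); first by rewrite leq_pexp2l.
  by rewrite leq_pmulr ?fact_gt0.
by rewrite expnS factS mulnCA leq_mul // ltnW.
Qed.

Lemma expn4_lt_fact (C : nat) : exists M, forall m, M <= m -> C * 4 ^ m < m`!.
Proof.
have [D D8] : exists D, forall m, 8 ^ m <= D * m`!.
  have [a a8] : exists a, a = 8 by exists 8.
  by exists (a ^ a) => m; rewrite -a8 expn_le_fact // a8.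
exists (D * C) => m leM; have := D8 m.
rewrite (_ : 8 = 4 * 2) // expnMn => le_m.
have m2 : D * C < 2 ^ m by apply: leq_ltn_trans leM (ltn_expl _ _).
have D_gt0 : 0 < D by case: D {D8 m2 leM} le_m => //; rewrite mul0n leqn0 muln_eq0 !expn_eq0.
rewrite -(ltn_pmul2l D_gt0); apply: leq_trans le_m.
by rewrite mulnA mulnC ltn_pmul2l ?expn_gt0.
Qed.

Local Open Scope ring_scope.

Section Harmonic.

Variable R : realFieldType.

(** The i-th factor is at most [(k + i) / (k + i - 1)], and these bounds telescope. *)
Lemma path_ltn_prod_ratio (k : nat) (s : seq nat) :
    (0 < k)%N -> path ltn k s ->
  k%:R * \prod_(p <- s) (p%:R / p.-1%:R) <= (k + size s)%:R :> R.
Proof.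
elim: s k => [|p s IH] k k_gt0 /=; first by rewrite big_nil mulr1 addn0.
case/andP=> lt_kp p_s; rewrite big_cons addnS -addSn mulrA.
have /(IH k.+1 isT) /(le_trans _) : path ltn k.+1 s.
  by case: s p_s {IH} => //= r s /andP[lt_pr ->]; rewrite (leq_ltn_trans lt_kp).
apply; apply: ler_wpM2r.
  by rewrite prodr_ge0 // => i _; rewrite divr_ge0.
rewrite mulrA ler_pdivrMr ?ltr0n; last by lia.
by rewrite -!natrM ler_nat; nia.
Qed.

(** A truncated Euler product: dividing the multiples of [p] by [p] gives [f <= P + f / p], so each
    new prime costs a factor [p / (p - 1)]. *)
Lemma smooth_harmonic_le (s : seq nat) (m : nat) : all prime s ->
  \sum_(l < m | all (mem s) (primes l.+1)) l.+1%:R^-1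
    <= \prod_(p <- s) (p%:R / p.-1%:R) :> R.
Proof.
elim: s => [_|p s IH /= /andP[p_pr /IH {}IH]].
  rewrite big_nil; case: m => [|m]; first by rewrite big_ord0.
  rewrite big_mkcond big_ord_recl /= invr1 big1 ?addr0 // => l _.
  case: ifP => // /allP/(_ (pdiv (bump 0 l).+1)).
  by rewrite mem_primes pdiv_prime // pdiv_dvd => /(_ isT).
have p_gt1 := prime_gt1 p_pr.
rewrite big_cons; set f := \sum_(l < m | _) _.
set P := \prod_(r <- s) _ in IH *.
have p1 : 0 < p.-1%:R :> R by rewrite ltr0n; lia.
have p0 : 0 < p%:R :> R by rewrite ltr0n; lia.
suff le_f : f <= P + p%:R^-1 * f.
  rewrite mulrAC ler_pdivlMr // -subn1 natrB ?prime_gt0 //.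
  have : p%:R * f <= p%:R * P + f.
    have -> : p%:R * P + f = p%:R * (P + p%:R^-1 * f) by field; rewrite gt_eqF.
    by rewrite ler_pM2l.
  lra.
rewrite {1}/f (bigID (fun l : 'I_m => (p %| l.+1)%N)) /= addrC; apply: lerD.
  apply: le_trans IH; rewrite [leLHS]big_mkcond [leRHS]big_mkcond.
  apply: ler_sum => l _; case: ifP => [/andP[/allP ps pNl]|_]; last by case: ifP.
  rewrite ifT //; apply/allP => r r_l; have := ps r r_l; rewrite !inE.
  by case/predU1P => // eq_rp; move: r_l; rewrite eq_rp mem_primes (negPf pNl) !andbF.
have [m0|m_gt0] := posnP m.
  by rewrite /f !big1 ?mulr0 // => -[l]; rewrite m0.
case: m m_gt0 @f {IH} => // m _ f.
rewrite (reindex_onto (fun j : 'I_m.+1 => inord (p * j.+1).-1 : 'I_m.+1)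
                      (fun l : 'I_m.+1 => inord (l.+1 %/ p).-1 : 'I_m.+1)) /=; last first.
  move=> l /andP[_ /dvdnP[k lE]]; apply: val_inj => /=.
  rewrite lE mulnK ?prime_gt0 //.
  have k_gt0 : (0 < k)%N by case: k lE.
  have lt_l := ltn_ord l.
  have k_le : (k <= k * p)%N by rewrite leq_pmulr // prime_gt0.
  by rewrite (@inordK _ k.-1) ?prednK // ?inordK; lia.
rewrite mulr_sumr [leRHS]big_mkcond [leLHS]big_mkcond; apply: ler_sum => j _.
have inv_ge0 : 0 <= p%:R^-1 * j.+1%:R^-1 :> R by rewrite mulr_ge0 ?invr_ge0 ?ler0n.
case: ifP => [/andP[/andP[ps pj] /eqP/(congr1 val) /= jE]|_]; last by case: ifP.
have pj_gt0 : (0 < p * j.+1)%N by rewrite muln_gt0 prime_gt0.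
(* Out of range, [inord] defaults to index 0, that is to the number 1, which [p] does not divide. *)
have [lt_m|ge_m] := ltnP (p * j.+1).-1 m.+1; last first.
  by move: pj; rewrite /inord val_insubd ltnNge ge_m /= dvdn1 gtn_eqF.
move: ps; rewrite inordK // prednK // => ps.
rewrite ifT ?natrM ?invfM //.
apply/allP => r r_j; apply: (allP ps); rewrite primesM ?r_j ?orbT // prime_gt0 //.
Qed.

(** Each dyadic block has [2 ^ t] terms, all at least [1 / 2 ^ t.+1], and so contributes at least
    [1 / 2]. *)
Lemma harmonic_ge (t m : nat) : (2 ^ t <= m)%N ->
  t%:R / 2 <= \sum_(l < m) l.+1%:R^-1 :> R.
Proof.
elim: t m => [|t IH] m le_m; first by rewrite mul0r sumr_ge0.
have le_t : (2 ^ t <= 2 ^ t.+1)%N by rewrite leq_exp2l.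
rewrite -(big_mkord predT (fun l => l.+1%:R^-1)) (@big_cat_nat _ _ _ (2 ^ t)) //=; last first.
  exact: leq_trans le_m.
rewrite -natr1 mulrDl big_mkord; apply: lerD; first exact: IH.
rewrite (@big_cat_nat _ _ _ (2 ^ t.+1)) //= -[leLHS]addr0; apply: lerD; last first.
  by apply: sumr_ge0.
apply: le_trans (_ : \sum_(2 ^ t <= l < 2 ^ t.+1) (2 ^ t.+1)%:R^-1 <= _).
  rewrite sumr_const_nat expnS mul2n -addnn addnK addnn -mul2n -[leRHS]mulr_natr natrM invfM.
  by rewrite -mulrA mulVf ?mulr1 ?mul1r // pnatr_eq0 expn_eq0.
rewrite [leLHS]big_nat_cond [leRHS]big_nat_cond; apply: ler_sum => l /andP[/andP[_ lt_l] _].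
by rewrite lef_pV2 ?posrE ?ltr0n ?expn_gt0 // ler_nat.
Qed.

End Harmonic.

Lemma non_smooth_harmonic_ge (R : realFieldType) (C W : nat) : (0 < C)%N ->
  exists n0, forall n, (n0 <= n)%N ->
    W%:R <= \sum_(l < n %/ 4 | ~~ all (mem (primes (C * n))) (primes l.+1)) l.+1%:R^-1 :> R.
Proof.
(* If [t < 2 * (1 + size s) + 2 * W], then [C * n < C * 2 ^ (t + 3)] is at most this constant times
   [4 ^ (1 + size s)], while [C * n] is at least [(1 + size s)!]. *)
move=> C_gt0; have [M MP] := expn4_lt_fact (C * 2 ^ (2 * W + 3)).
exists (4 * 2 ^ (2 * M + 2 * W))%N => n le_n.
have n_gt0 : (0 < n)%N by apply: leq_trans le_n; rewrite muln_gt0 expn_gt0.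
set s := primes (C * n); set m := (n %/ 4)%N; pose t := trunc_log 2 m.
have le_m : (2 ^ (2 * M + 2 * W) <= m)%N by rewrite leq_divRL // mulnC.
have m_gt0 : (0 < m)%N by apply: leq_trans le_m; rewrite expn_gt0.
have le_t : (2 * M + 2 * W <= t)%N.
  exact: trunc_log_max.
have [tm mt] : (2 ^ t <= m)%N /\ (m < 2 ^ t.+1)%N.
  by rewrite trunc_logP // trunc_log_ltn.
have path_s : path ltn 1 s.
  rewrite path_min_sorted ?sorted_primes //; apply/allP => p.
  by rewrite mem_primes => /andP[/prime_gt1].
have fact_s : ((1 + size s)`! <= C * n)%N.
  apply: leq_trans (path_ltn_prod path_s) _.
  by rewrite mul1n prod_primes_le // muln_gt0 C_gt0.
have le_s : (2 * (1 + size s) + 2 * W <= t)%N.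
  rewrite leqNgt; apply/negP => lt_t.
  have /MP : (M <= 1 + size s)%N by lia.
  apply/negP; rewrite -leqNgt (leq_trans fact_s) // -mulnA leq_mul2l; apply/orP; right.
  rewrite (_ : 4 = 2 ^ 2)%N // -expnM -expnD.
  have : (n < 4 * 2 ^ t.+1)%N by rewrite mulnC -ltn_divLR.
  rewrite (_ : 4 = 2 ^ 2)%N // -expnD => /ltnW /leq_trans; apply.
  by rewrite leq_exp2l //; lia.
have := harmonic_ge R tm; rewrite (bigID (fun l : 'I_m => all (mem s) (primes l.+1))) /=.
set f := (X in X + _); set g := (X in _ + X) => le_fg; suff: W%:R <= g by [].
have : f <= (1 + size s)%:R.
  apply: le_trans (smooth_harmonic_le R (s := s) m _) _.
    by apply/allP => p; rewrite mem_primes => /andP[].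
  by have := path_ltn_prod_ratio R (ltn0Sn 0) path_s; rewrite mul1r.
have : (2 * (1 + size s) + 2 * W)%:R <= t%:R :> R by rewrite ler_nat.
by rewrite natrD !natrM; move: le_fg; clearbody f g; lra.
Qed.

(** Every term is at most 1, so the first partial sum to reach [W] overshoots by at most 1. The
    upper bound serves the Markov term, which grows with the mass. *)
Lemma harmonic_trim (R : realFieldType) (P : pred nat) (W : R) (m : nat) : 0 <= W ->
    W <= \sum_(l < m | P l) l.+1%:R^-1 ->
  exists2 k, (k <= m)%N & W <= \sum_(l < k | P l) l.+1%:R^-1 <= W + 1.
Proof.
move=> W_ge0; elim: m => [|m IH] le_W.
  by exists 0%N => //; rewrite le_W big_ord0 addr_ge0.
have [/IH[k le_k kP]|lt_W] := leP W (\sum_(l < m | P l) l.+1%:R^-1).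
  by exists k => //; apply: leqW.
exists m.+1 => //; rewrite le_W /= big_mkcond big_ord_recr /= -big_mkcond /=.
apply: lerD; first exact: ltW.
by case: ifP => // _; rewrite invf_le1 ?ltr0n // ler1n.
Qed.

(** * Choice of the lengths and the limit *)

Lemma p_le (R : realType) (W : nat) : (0 < W)%N ->
  exists n0, forall n, (n0 <= n)%N -> p_ R n <= 2 / W%:R.
Proof.
(* With mass at most [W + 1], the Markov term is at most [4 * (W + 1) / K = 1 / W]. *)
move=> W_gt0; pose K := (W * (4 * W.+1))%N.
have K_gt0 : (0 < K)%N by rewrite muln_gt0 W_gt0.
(* A prime not dividing [N], the product of the factorial of [K] and [n], exceeds [K] and does not
   divide [n]. *)
have [n0 n0P] := @non_smooth_harmonic_ge R (K`!) W (fact_gt0 K).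
exists n0 => n /n0P; set N := (K`! * n)%N => geW.
pose P l := ~~ all (mem (primes N)) (primes l.+1).
have [k le_k /andP[kW kW1]] := harmonic_trim (P := P) (ler0n R W) geW.
pose A l := (l <= k)%N && ~~ all (mem (primes N)) (primes l).
(* The filtered list is nonempty for [l] in [A], so the default 0 never occurs there. *)
pose q l := head 0%N [seq p <- primes l | p \notin primes N].
have Wk : harmonic_mass R 'I_n A = \sum_(l < k | P l) l.+1%:R^-1.
  rewrite /harmonic_mass card_ord (big_ord_widen_cond n P (fun l => l.+1%:R^-1)).
    by apply: eq_bigl => l; rewrite andbC.
  by rewrite (leq_trans le_k) // leq_div.
have W0 : 0 < W%:R :> R by rewrite ltr0n.
have mass_gt0 : 0 < harmonic_mass R 'I_n A by rewrite Wk (lt_le_trans _ kW).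
have qP l : A l -> [/\ (4 * l <= n)%N, prime (q l), (q l %| l)%N & ~~ (q l %| N)%N].
  move=> /andP[le_l /allPn[p p_l pNN]].
  have : q l \in [seq p <- primes l | p \notin primes N].
    have : p \in [seq p <- primes l | p \notin primes N] by rewrite mem_filter pNN.
    by rewrite /q; case: [seq _ <- _ | _] => //= r s _; rewrite mem_head.
  rewrite mem_filter !mem_primes => /andP[+ /and3P[q_pr l_gt0 q_l]]; rewrite q_pr /= => qN.
  have n_gt0 : (0 < n)%N by case: (n) le_k => //; case: (k) le_l => //; rewrite leqNgt l_gt0.
  split => //; first by rewrite mulnC -leq_divRL // (leq_trans le_l).
  by move: qN; rewrite muln_gt0 fact_gt0 n_gt0.
have qK l : A l -> (K < q l)%N.
  case/qP => _ q_pr _; apply: contraR; rewrite -leqNgt => le_q.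
  by rewrite dvdn_mulr // dvdn_fact // prime_gt0.
have q_odd l : A l -> odd (q l).
  move=> Al; have [_ q_pr _ _] := qP l Al; case: (even_prime q_pr) => // q2.
  by have := qK l Al; rewrite q2; move: W_gt0; rewrite /K; lia.
have qP' l : A l -> [/\ (4 * l <= n)%N, prime (q l), odd (q l), (q l %| l)%N & ~~ (q l %| n)%N].
  move=> Al; have [l4 q_pr ql qN] := qP l Al; split; rewrite ?q_odd //.
  by apply: contra qN => /dvdn_mull->.
have := card_goodGamma_le K_gt0 qP' (fun l Al => ltnW (qK l Al)) mass_gt0.
rewrite /p_ card_Sn ler_pdivrMr ?ltr0n ?fact_gt0 // [_ * n`!%:R]mulrC => /le_trans; apply.
rewrite ler_wpM2l ?ler0n // Wk [leRHS]mulr_natl mulr2n; apply: lerD.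
  by rewrite lef_pV2 // posrE (lt_le_trans _ kW).
rewrite ler_pdivrMr ?ltr0n // /K natrM mulrA mulVf ?gt_eqF // mul1r natrM.
by rewrite ler_wpM2l // -natr1.
Qed.

Import numFieldNormedType.Exports.
Local Open Scope classical_set_scope.
Local Open Scope ring_scope.

Theorem theorem6p2 (R : realType) : (@p_ R) @ \oo --> (0 : R).
Proof.
apply/cvgr0Pnorm_le => e e_gt0.
(* This integer exceeds [2 / e], which makes the bound [2 / W] at most [e]. *)
have [n0 n0P] := @p_le R (Num.truncn (2 / e)).+1 isT.
exists n0 => // n /= /n0P p_le; rewrite ger0_norm ?divr_ge0 //.
apply: le_trans p_le _; rewrite ler_pdivrMr ?ltr0n // mulrC -ler_pdivrMr //.
by rewrite ltW // truncnS_gt.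
Qed.
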